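(* Work in intensional Martin-Löf type theory with propositional truncation satisfying the judgmental computation rule $\mathrm{rec}(P,h,f,|x|)\equiv f(x)$. Let $X,Y:\mathcal U$, $f:X\to Y$, $\bar f:\lVert X\rVert\to Y$ and $h:\prod_{x:X}f(x)=\bar f(|x|)$. Then one can construct $f':\lVert X\rVert\to Y$ such that for a variable $x:X$ one has the judgmental equality $f(x)\equiv f'(|x|)$; in particular $\lambda x.\,\mathsf{refl}_{f(x)}$ is a term of type $\prod_{x:X}f(x)=f'(|x|)$.
   Context: Intensional Martin-Löf type theory with a universe $\mathcal U$, $\Sigma$, $\Pi$, $+$, identity types (J only; no UIP/K) and judgmental $\eta$ for functions. $\mathrm{isProp}(A):\equiv\prod_{a,b:A}a=b$. Propositional truncation: for every $A:\mathcal U$ a type $\lVert A\rVert:\mathcal U$ with $|{-}|:A\to\lVert A\rVert$, a proof of $\mathrm{isProp}(\lVert A\rVert)$, and $\mathrm{rec}:\prod_{P:\mathcal U}\mathrm{isProp}(P)\to(A\to P)\to\lVert A\rVert\to P$, with $\mathrm{rec}(P,h,f,|x|)\equiv f(x)$ judgmentally. *)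

(* Defs.v *)
(* Judgmental equality cannot be expressed by a proposition inside Rocq, so the
   type theory is formalized as an object language: raw terms and the
   inductively defined derivable judgments. *)
From Stdlib Require Import List.
Import ListNotations.

(* Raw terms with de Bruijn indices; [tVar 0] is the innermost variable.
   Bound variables:
     tPi A B, tSig A B, tLam A t       one in [B], resp. [t];
     tSplit C d p                      one in [C]; two in [d] (the first
                                       component is 1, the second is 0);
     tCase C d e s                     one in each of [C], [d], [e];
     tJ C d a b p                      three in [C] (left endpoint 2, right
                                       endpoint 1, path 0); one in [d].
   The universe is a la Russell: codes and types share one syntax. *)
Inductive tm : Type :=
| tVar (n : nat)
| tU
| tPi (A B : tm)
| tLam (A t : tm)
| tApp (f a : tm)
| tSig (A B : tm)
| tPair (a b : tm)
| tSplit (C d p : tm)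
| tSum (A B : tm)
| tInl (a : tm)
| tInr (b : tm)
| tCase (C d e s : tm)
| tId (A a b : tm)
| tRefl (a : tm)
| tJ (C d a b p : tm)
| tTrunc (A : tm)
| tTr (a : tm)
| tTrProp (A : tm)
| tTrRec (P h f t : tm).

Definition up_ren (r : nat -> nat) (n : nat) : nat :=
  match n with 0 => 0 | S m => S (r m) end.

Fixpoint ren (r : nat -> nat) (t : tm) : tm :=
  let r1 := up_ren r in
  let r2 := up_ren r1 in
  let r3 := up_ren r2 in
  match t with
  | tVar n => tVar (r n)
  | tU => tU
  | tPi A B => tPi (ren r A) (ren r1 B)
  | tLam A t => tLam (ren r A) (ren r1 t)
  | tApp f a => tApp (ren r f) (ren r a)
  | tSig A B => tSig (ren r A) (ren r1 B)
  | tPair a b => tPair (ren r a) (ren r b)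
  | tSplit C d p => tSplit (ren r1 C) (ren r2 d) (ren r p)
  | tSum A B => tSum (ren r A) (ren r B)
  | tInl a => tInl (ren r a)
  | tInr b => tInr (ren r b)
  | tCase C d e s => tCase (ren r1 C) (ren r1 d) (ren r1 e) (ren r s)
  | tId A a b => tId (ren r A) (ren r a) (ren r b)
  | tRefl a => tRefl (ren r a)
  | tJ C d a b p => tJ (ren r3 C) (ren r1 d) (ren r a) (ren r b) (ren r p)
  | tTrunc A => tTrunc (ren r A)
  | tTr a => tTr (ren r a)
  | tTrProp A => tTrProp (ren r A)
  | tTrRec P h f t => tTrRec (ren r P) (ren r h) (ren r f) (ren r t)
  end.

Definition wk (t : tm) : tm := ren S t.

Definition scons (t : tm) (s : nat -> tm) (n : nat) : tm :=
  match n with 0 => t | S m => s m end.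

Definition up (s : nat -> tm) : nat -> tm :=
  scons (tVar 0) (fun n => wk (s n)).

Fixpoint subst (s : nat -> tm) (t : tm) : tm :=
  let s1 := up s in
  let s2 := up s1 in
  let s3 := up s2 in
  match t with
  | tVar n => s n
  | tU => tU
  | tPi A B => tPi (subst s A) (subst s1 B)
  | tLam A t => tLam (subst s A) (subst s1 t)
  | tApp f a => tApp (subst s f) (subst s a)
  | tSig A B => tSig (subst s A) (subst s1 B)
  | tPair a b => tPair (subst s a) (subst s b)
  | tSplit C d p => tSplit (subst s1 C) (subst s2 d) (subst s p)
  | tSum A B => tSum (subst s A) (subst s B)
  | tInl a => tInl (subst s a)
  | tInr b => tInr (subst s b)
  | tCase C d e u => tCase (subst s1 C) (subst s1 d) (subst s1 e) (subst s u)
  | tId A a b => tId (subst s A) (subst s a) (subst s b)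
  | tRefl a => tRefl (subst s a)
  | tJ C d a b p => tJ (subst s3 C) (subst s1 d) (subst s a) (subst s b) (subst s p)
  | tTrunc A => tTrunc (subst s A)
  | tTr a => tTr (subst s a)
  | tTrProp A => tTrProp (subst s A)
  | tTrRec P h f t => tTrRec (subst s P) (subst s h) (subst s f) (subst s t)
  end.

Definition inst1 (t a : tm) : tm := subst (scons a tVar) t.
Definition inst2 (t a b : tm) : tm := subst (scons b (scons a tVar)) t.
Definition inst3 (t a b c : tm) : tm :=
  subst (scons c (scons b (scons a tVar))) t.

Definition tArr (A B : tm) : tm := tPi A (wk B).

Definition tIsProp (A : tm) : tm :=
  tPi A (tPi (wk A) (tId (wk (wk A)) (tVar 1) (tVar 0))).

(* The motives of the eliminators, moved to the contexts of their branches: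
   C(pair x y) for x : A, y : B(x);  C(inl x) for x : A;  C(inr y) for y : B;
   C(x, x, refl x) for x : A. *)
Definition motive_pair (C : tm) : tm :=
  subst (scons (tPair (tVar 1) (tVar 0)) (fun n => tVar (S (S n)))) C.
Definition motive_inl (C : tm) : tm :=
  subst (scons (tInl (tVar 0)) (fun n => tVar (S n))) C.
Definition motive_inr (C : tm) : tm :=
  subst (scons (tInr (tVar 0)) (fun n => tVar (S n))) C.
Definition motive_refl (C : tm) : tm :=
  subst (scons (tRefl (tVar 0)) (scons (tVar 0) (scons (tVar 0)
    (fun n => tVar (S n))))) C.

(* Contexts list the most recent variable first. *)
Definition ctx : Type := list tm.

(* x : A, y : A, p : x = y *)
Definition ctx_J (G : ctx) (A : tm) : ctx :=
  tId (wk (wk A)) (tVar 1) (tVar 0) :: wk A :: A :: G.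

(* wf G          G is a context
   isty G A      G |- A type
   eqty G A B    G |- A == B type   (judgmental)
   hastm G t A   G |- t : A
   eqtm G t u A  G |- t == u : A    (judgmental) *)
Inductive wf : ctx -> Prop :=
| wf_nil : wf []
| wf_cons G A : wf G -> isty G A -> wf (A :: G)

with isty : ctx -> tm -> Prop :=
| isty_U G : wf G -> isty G tU
| isty_El G A : hastm G A tU -> isty G A
| isty_Pi G A B : isty G A -> isty (A :: G) B -> isty G (tPi A B)
| isty_Sig G A B : isty G A -> isty (A :: G) B -> isty G (tSig A B)
| isty_Sum G A B : isty G A -> isty G B -> isty G (tSum A B)
| isty_Id G A a b :
    isty G A -> hastm G a A -> hastm G b A -> isty G (tId A a b)

with eqty : ctx -> tm -> tm -> Prop :=
| eqty_refl G A : isty G A -> eqty G A A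
| eqty_sym G A B : eqty G A B -> eqty G B A
| eqty_trans G A B C : eqty G A B -> eqty G B C -> eqty G A C
| eqty_El G A B : eqtm G A B tU -> eqty G A B
| eqty_Pi G A A' B B' :
    isty G A -> eqty G A A' -> eqty (A :: G) B B' ->
    eqty G (tPi A B) (tPi A' B')
| eqty_Sig G A A' B B' :
    isty G A -> eqty G A A' -> eqty (A :: G) B B' ->
    eqty G (tSig A B) (tSig A' B')
| eqty_Sum G A A' B B' :
    eqty G A A' -> eqty G B B' -> eqty G (tSum A B) (tSum A' B')
| eqty_Id G A A' a a' b b' :
    eqty G A A' -> eqtm G a a' A -> eqtm G b b' A ->
    eqty G (tId A a b) (tId A' a' b')

with hastm : ctx -> tm -> tm -> Prop :=
| hastm_var G n A :
    wf G -> nth_error G n = Some A ->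
    hastm G (tVar n) (ren (fun k => S n + k) A)
| hastm_conv G t A B : hastm G t A -> eqty G A B -> hastm G t B
(* closure of the universe *)
| hastm_Pi G A B :
    hastm G A tU -> hastm (A :: G) B tU -> hastm G (tPi A B) tU
| hastm_Sig G A B :
    hastm G A tU -> hastm (A :: G) B tU -> hastm G (tSig A B) tU
| hastm_Sum G A B :
    hastm G A tU -> hastm G B tU -> hastm G (tSum A B) tU
| hastm_Id G A a b :
    hastm G A tU -> hastm G a A -> hastm G b A -> hastm G (tId A a b) tU
| hastm_Trunc G A : hastm G A tU -> hastm G (tTrunc A) tU
(* dependent functions *)
| hastm_lam G A B t :
    isty G A -> hastm (A :: G) t B -> hastm G (tLam A t) (tPi A B)
| hastm_app G A B f a :
    hastm G f (tPi A B) -> hastm G a A -> hastm G (tApp f a) (inst1 B a)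
(* dependent pairs *)
| hastm_pair G A B a b :
    isty G A -> isty (A :: G) B -> hastm G a A -> hastm G b (inst1 B a) ->
    hastm G (tPair a b) (tSig A B)
| hastm_split G A B C d p :
    isty G A -> isty (A :: G) B -> isty (tSig A B :: G) C ->
    hastm (B :: A :: G) d (motive_pair C) -> hastm G p (tSig A B) ->
    hastm G (tSplit C d p) (inst1 C p)
(* coproducts *)
| hastm_inl G A B a :
    isty G B -> hastm G a A -> hastm G (tInl a) (tSum A B)
| hastm_inr G A B b :
    isty G A -> hastm G b B -> hastm G (tInr b) (tSum A B)
| hastm_case G A B C d e s :
    isty G A -> isty G B -> isty (tSum A B :: G) C ->
    hastm (A :: G) d (motive_inl C) -> hastm (B :: G) e (motive_inr C) ->
    hastm G s (tSum A B) ->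
    hastm G (tCase C d e s) (inst1 C s)
(* identity types *)
| hastm_refl G A a : hastm G a A -> hastm G (tRefl a) (tId A a a)
| hastm_J G A C d a b p :
    isty G A -> isty (ctx_J G A) C -> hastm (A :: G) d (motive_refl C) ->
    hastm G a A -> hastm G b A -> hastm G p (tId A a b) ->
    hastm G (tJ C d a b p) (inst3 C a b p)
(* propositional truncation *)
| hastm_tr G A a :
    hastm G A tU -> hastm G a A -> hastm G (tTr a) (tTrunc A)
| hastm_trProp G A :
    hastm G A tU -> hastm G (tTrProp A) (tIsProp (tTrunc A))
| hastm_trRec G A P h f t :
    hastm G A tU -> hastm G P tU -> hastm G h (tIsProp P) ->
    hastm G f (tArr A P) -> hastm G t (tTrunc A) ->
    hastm G (tTrRec P h f t) P

with eqtm : ctx -> tm -> tm -> tm -> Prop :=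
| eqtm_refl G t A : hastm G t A -> eqtm G t t A
| eqtm_sym G t u A : eqtm G t u A -> eqtm G u t A
| eqtm_trans G t u v A : eqtm G t u A -> eqtm G u v A -> eqtm G t v A
| eqtm_conv G t u A B : eqtm G t u A -> eqty G A B -> eqtm G t u B
(* computation rules, and eta for functions *)
| eqtm_beta G A B t a :
    isty G A -> hastm (A :: G) t B -> hastm G a A ->
    eqtm G (tApp (tLam A t) a) (inst1 t a) (inst1 B a)
| eqtm_eta G A B f :
    hastm G f (tPi A B) ->
    eqtm G f (tLam A (tApp (wk f) (tVar 0))) (tPi A B)
| eqtm_split_pair G A B C d a b :
    isty G A -> isty (A :: G) B -> isty (tSig A B :: G) C ->
    hastm (B :: A :: G) d (motive_pair C) ->
    hastm G a A -> hastm G b (inst1 B a) ->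
    eqtm G (tSplit C d (tPair a b)) (inst2 d a b) (inst1 C (tPair a b))
| eqtm_case_inl G A B C d e a :
    isty G A -> isty G B -> isty (tSum A B :: G) C ->
    hastm (A :: G) d (motive_inl C) -> hastm (B :: G) e (motive_inr C) ->
    hastm G a A ->
    eqtm G (tCase C d e (tInl a)) (inst1 d a) (inst1 C (tInl a))
| eqtm_case_inr G A B C d e b :
    isty G A -> isty G B -> isty (tSum A B :: G) C ->
    hastm (A :: G) d (motive_inl C) -> hastm (B :: G) e (motive_inr C) ->
    hastm G b B ->
    eqtm G (tCase C d e (tInr b)) (inst1 e b) (inst1 C (tInr b))
| eqtm_J_refl G A C d a :
    isty G A -> isty (ctx_J G A) C -> hastm (A :: G) d (motive_refl C) ->
    hastm G a A ->
    eqtm G (tJ C d a a (tRefl a)) (inst1 d a) (inst3 C a a (tRefl a))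
| eqtm_trRec_tr G A P h f a :
    hastm G A tU -> hastm G P tU -> hastm G h (tIsProp P) ->
    hastm G f (tArr A P) -> hastm G a A ->
    eqtm G (tTrRec P h f (tTr a)) (tApp f a) P
(* congruence rules *)
| eqtm_Pi G A A' B B' :
    hastm G A tU -> eqtm G A A' tU -> eqtm (A :: G) B B' tU ->
    eqtm G (tPi A B) (tPi A' B') tU
| eqtm_Sig G A A' B B' :
    hastm G A tU -> eqtm G A A' tU -> eqtm (A :: G) B B' tU ->
    eqtm G (tSig A B) (tSig A' B') tU
| eqtm_Sum G A A' B B' :
    eqtm G A A' tU -> eqtm G B B' tU -> eqtm G (tSum A B) (tSum A' B') tU
| eqtm_Id G A A' a a' b b' :
    eqtm G A A' tU -> eqtm G a a' A -> eqtm G b b' A ->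
    eqtm G (tId A a b) (tId A' a' b') tU
| eqtm_Trunc G A A' : eqtm G A A' tU -> eqtm G (tTrunc A) (tTrunc A') tU
| eqtm_lam G A A' B t t' :
    isty G A -> eqty G A A' -> eqtm (A :: G) t t' B ->
    eqtm G (tLam A t) (tLam A' t') (tPi A B)
| eqtm_app G A B f f' a a' :
    eqtm G f f' (tPi A B) -> eqtm G a a' A ->
    eqtm G (tApp f a) (tApp f' a') (inst1 B a)
| eqtm_pair G A B a a' b b' :
    isty G A -> isty (A :: G) B -> eqtm G a a' A -> eqtm G b b' (inst1 B a) ->
    eqtm G (tPair a b) (tPair a' b') (tSig A B)
| eqtm_split G A B C C' d d' p p' :
    isty G A -> isty (A :: G) B -> eqty (tSig A B :: G) C C' ->
    eqtm (B :: A :: G) d d' (motive_pair C) -> eqtm G p p' (tSig A B) ->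
    eqtm G (tSplit C d p) (tSplit C' d' p') (inst1 C p)
| eqtm_inl G A B a a' :
    isty G B -> eqtm G a a' A -> eqtm G (tInl a) (tInl a') (tSum A B)
| eqtm_inr G A B b b' :
    isty G A -> eqtm G b b' B -> eqtm G (tInr b) (tInr b') (tSum A B)
| eqtm_case G A B C C' d d' e e' s s' :
    isty G A -> isty G B -> eqty (tSum A B :: G) C C' ->
    eqtm (A :: G) d d' (motive_inl C) -> eqtm (B :: G) e e' (motive_inr C) ->
    eqtm G s s' (tSum A B) ->
    eqtm G (tCase C d e s) (tCase C' d' e' s') (inst1 C s)
| eqtm_refl_cong G A a a' :
    eqtm G a a' A -> eqtm G (tRefl a) (tRefl a') (tId A a a)
| eqtm_J G A C C' d d' a a' b b' p p' :
    isty G A -> eqty (ctx_J G A) C C' -> eqtm (A :: G) d d' (motive_refl C) ->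
    eqtm G a a' A -> eqtm G b b' A -> eqtm G p p' (tId A a b) ->
    eqtm G (tJ C d a b p) (tJ C' d' a' b' p') (inst3 C a b p)
| eqtm_tr G A a a' :
    hastm G A tU -> eqtm G a a' A -> eqtm G (tTr a) (tTr a') (tTrunc A)
| eqtm_trProp G A A' :
    eqtm G A A' tU ->
    eqtm G (tTrProp A) (tTrProp A') (tIsProp (tTrunc A))
| eqtm_trRec G A P P' h h' f f' t t' :
    hastm G A tU -> eqtm G P P' tU -> eqtm G h h' (tIsProp P) ->
    eqtm G f f' (tArr A P) -> eqtm G t t' (tTrunc A) ->
    eqtm G (tTrRec P h f t) (tTrRec P' h' f' t') P.

(* Main.v *)
(** For [z : ||X||] the singleton [sum (y : Y), y = fbar z] is contractible, hence a
    proposition, so the truncation eliminates into it: send [x : X] to [f x] together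
    with the path [f x = fbar |x| = fbar z], whose second half comes from [||X||]
    being a proposition.  The first projection of the result at [z] is [f' z], and at
    [z = |x|] both the truncation and the projection compute, so that [f' |x|] is
    judgmentally [f x].  The term [f' z] is a construction uniform in [z] and typed in
    every context, so weakening is the only structural rule that has to be shown
    admissible. *)
Require Import Defs.
From Stdlib Require Import List.
Import ListNotations.

(** * Renaming and substitution *)

Lemma up_ext s s' : (forall n, s n = s' n) -> forall n, up s n = up s' n.
Proof. intros E [|n]; cbn; [reflexivity | now rewrite E]. Qed.

Lemma subst_ext s s' t : (forall n, s n = s' n) -> subst s t = subst s' t.
Proof.
  revert s s'; induction t; intros s s' E; cbn; auto; f_equal; auto using up_ext.
Qed.

Lemma up_id s : (forall n, s n = tVar n) -> forall n, up s n = tVar n.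
Proof. intros E [|n]; cbn; [reflexivity | now rewrite E]. Qed.

Lemma subst_id s t : (forall n, s n = tVar n) -> subst s t = t.
Proof.
  revert s; induction t; intros s E; cbn; auto; f_equal; auto using up_id.
Qed.

Lemma up_comp_ren s r s' :
  (forall n, s (r n) = s' n) -> forall n, up s (up_ren r n) = up s' n.
Proof. intros E [|n]; cbn; [reflexivity | now rewrite E]. Qed.

Lemma subst_ren s r s' t :
  (forall n, s (r n) = s' n) -> subst s (ren r t) = subst s' t.
Proof.
  revert s r s'; induction t; intros s r s' E; cbn; auto;
    f_equal; auto using up_comp_ren.
Qed.

Lemma ren_as_subst r t : ren r t = subst (fun n => tVar (r n)) t.
Proof.
  rewrite <- (subst_id tVar (ren r t)) by reflexivity.
  now apply subst_ren.
Qed.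

Lemma ren_comp_up r s s' :
  (forall n, ren r (s n) = s' n) -> forall n, ren (up_ren r) (up s n) = up s' n.
Proof.
  intros E [|n]; cbn; [reflexivity |].
  rewrite <- E. unfold wk. rewrite !(ren_as_subst _ (ren _ _)).
  now rewrite !(subst_ren _ _ (fun k => tVar (S (r k)))).
Qed.

Lemma ren_subst r s s' t :
  (forall n, ren r (s n) = s' n) -> ren r (subst s t) = subst s' t.
Proof.
  revert r s s'; induction t; intros r s s' E; cbn; auto;
    f_equal; auto using ren_comp_up.
Qed.

Lemma up_comp_up s1 s2 s' :
  (forall n, subst s2 (s1 n) = s' n) ->
  forall n, subst (up s2) (up s1 n) = up s' n.
Proof.
  intros E [|n]; cbn; [reflexivity |].
  rewrite <- E. unfold wk.
  rewrite (subst_ren _ _ (fun k => wk (s2 k))) by reflexivity.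
  symmetry. now apply ren_subst.
Qed.

Lemma subst_subst s1 s2 s' t :
  (forall n, subst s2 (s1 n) = s' n) -> subst s2 (subst s1 t) = subst s' t.
Proof.
  revert s1 s2 s'; induction t; intros s1 s2 s' E; cbn; auto;
    f_equal; auto using up_comp_up.
Qed.

Create HintDb terms.
#[local] Hint Unfold tIsProp tArr ctx_J inst1 inst2 inst3 motive_pair motive_inl
  motive_inr motive_refl : terms.

Ltac tm_norm :=
  autounfold with terms; simpl;
  repeat (first [ progress unfold wk
                | rewrite ren_as_subst
                | erewrite subst_subst by (intro; reflexivity) ]; simpl).

(* Six cases reach past the explicitly listed values of every substitution that
   occurs. *)
Ltac same_values := let n := fresh "n" in
  intro n; do 6 (try destruct n as [|n]); tm_norm; reflexivity.

Ltac tm_eq :=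
  tm_norm;
  repeat first
    [ reflexivity
    | match goal with
      | |- subst _ ?t = subst _ ?t => apply subst_ext; same_values
      | |- subst _ ?t = ?t => apply subst_id; same_values
      | |- ?t = subst _ ?t => symmetry; apply subst_id; same_values
      | |- subst _ _ = _ => fail 1
      | |- _ = subst _ _ => fail 1
      end
    | f_equal ].

Lemma ren_wk r t : ren (up_ren r) (wk t) = wk (ren r t).
Proof. tm_eq. Qed.

Lemma ren_inst1 r t a : ren r (inst1 t a) = inst1 (ren (up_ren r) t) (ren r a).
Proof. tm_eq. Qed.

Lemma ren_inst2 r t a b :
  ren r (inst2 t a b) = inst2 (ren (up_ren (up_ren r)) t) (ren r a) (ren r b).
Proof. tm_eq. Qed.

Lemma ren_inst3 r t a b c :
  ren r (inst3 t a b c) =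
  inst3 (ren (up_ren (up_ren (up_ren r))) t) (ren r a) (ren r b) (ren r c).
Proof. tm_eq. Qed.

Lemma ren_motive_pair r C :
  ren (up_ren (up_ren r)) (motive_pair C) = motive_pair (ren (up_ren r) C).
Proof. tm_eq. Qed.

Lemma ren_motive_inl r C :
  ren (up_ren r) (motive_inl C) = motive_inl (ren (up_ren r) C).
Proof. tm_eq. Qed.

Lemma ren_motive_inr r C :
  ren (up_ren r) (motive_inr C) = motive_inr (ren (up_ren r) C).
Proof. tm_eq. Qed.

Lemma ren_motive_refl r C :
  ren (up_ren r) (motive_refl C) =
  motive_refl (ren (up_ren (up_ren (up_ren r))) C).
Proof. tm_eq. Qed.

Lemma ren_isProp r A : ren r (tIsProp A) = tIsProp (ren r A).
Proof. tm_eq. Qed.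

Lemma ren_arr r A B : ren r (tArr A B) = tArr (ren r A) (ren r B).
Proof. tm_eq. Qed.

(** * Weakening *)

Scheme wf_mut := Induction for wf Sort Prop
with isty_mut := Induction for isty Sort Prop
with eqty_mut := Induction for eqty Sort Prop
with hastm_mut := Induction for hastm Sort Prop
with eqtm_mut := Induction for eqtm Sort Prop.
Combined Scheme judgment_ind from wf_mut, isty_mut, eqty_mut, hastm_mut, eqtm_mut.

Lemma judgment_wf :
  (forall G, wf G -> True) /\
  (forall G A, isty G A -> wf G) /\
  (forall G A B, eqty G A B -> wf G) /\
  (forall G t A, hastm G t A -> wf G) /\
  (forall G t u A, eqtm G t u A -> wf G).
Proof. apply judgment_ind; auto. Qed.

Lemma isty_wf {G A} : isty G A -> wf G.
Proof. apply judgment_wf. Qed.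

Lemma wf_extend {G A} : isty G A -> wf (A :: G).
Proof. eauto using wf_cons, isty_wf. Qed.

Lemma hastm_conv_eq {G t A B} : hastm G t A -> A = B -> hastm G t B.
Proof. now intros H <-. Qed.

Lemma eqtm_conv_eq {G t u u' A B} :
  eqtm G t u A -> u = u' -> A = B -> eqtm G t u' B.
Proof. now intros E <- <-. Qed.

Lemma hastm_var_eq {G n A B} :
  wf G -> nth_error G n = Some A -> ren (fun k => S n + k) A = B ->
  hastm G (tVar n) B.
Proof. intros W E <-. now apply hastm_var. Qed.

Lemma hastm_var0 {G A} : isty G A -> hastm (A :: G) (tVar 0) (wk A).
Proof. intros HA. exact (hastm_var _ 0 _ (wf_extend HA) eq_refl). Qed.

(* Positions are compared instead of typing [tVar (r n)], since the latter would
   not be stable under shifts before weakening is known to be admissible. *)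
Definition wt_ren (D : ctx) (r : nat -> nat) (G : ctx) : Prop :=
  wf D /\
  forall n A, nth_error G n = Some A ->
  exists B, nth_error D (r n) = Some B /\
    ren (fun k => S (r n) + k) B = ren r (ren (fun k => S n + k) A).

Lemma wt_ren_wf {D r G} : wt_ren D r G -> wf D.
Proof. now intros []. Qed.

Lemma wt_ren_var {D r G n A} : wt_ren D r G -> nth_error G n = Some A ->
  hastm D (tVar (r n)) (ren r (ren (fun k => S n + k) A)).
Proof.
  intros [W Hr] E. destruct (Hr n A E) as [B [EB Q]].
  exact (hastm_var_eq W EB Q).
Qed.

Lemma wt_ren_shift {D r G A} :
  wt_ren D r G -> isty D A -> wt_ren (A :: D) (fun k => S (r k)) G.
Proof.
  intros [_ Hr] HA. split; [exact (wf_extend HA) |]. intros n B E.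
  destruct (Hr n B E) as [B' [E' Q]]. exists B'. split; [exact E' |].
  transitivity (wk (ren (fun k => S (r n) + k) B')); [| rewrite Q]; tm_eq.
Qed.

Lemma wt_ren_up {D r G A A'} :
  wt_ren D r G -> isty D A' -> ren r A = A' -> wt_ren (A' :: D) (up_ren r) (A :: G).
Proof.
  intros Hr HA <-. split; [exact (wf_extend HA) |]. intros [|n] B E; cbn in E.
  - injection E as <-. exists (ren r A). split; [reflexivity | tm_eq].
  - destruct (proj2 (wt_ren_shift Hr HA) n B E) as [B' [E' Q]].
    exists B'. split; [exact E' |]. cbn [up_ren]. rewrite Q. tm_eq.
Qed.

Lemma isty_ctx_J_head_of_wk {G A} :
  wf (wk A :: A :: G) -> isty (wk A :: A :: G) (wk (wk A)) ->
  isty (wk A :: A :: G) (tId (wk (wk A)) (tVar 1) (tVar 0)).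
Proof.
  intros W HA. apply isty_Id; [exact HA | |];
    (eapply hastm_var_eq; [exact W | reflexivity | tm_eq]).
Qed.

(* The hypothesis on [A], used along [r] followed by shifts, provides the
   weakenings of [A] before weakening is known to be admissible. *)
Lemma wt_ren_ctx_J {D r G A} :
  (forall D r, wt_ren D r G -> isty D (ren r A)) ->
  wt_ren D r G ->
  wt_ren (ctx_J D (ren r A)) (up_ren (up_ren (up_ren r))) (ctx_J G A).
Proof.
  intros HA Hr.
  assert (HA0 := HA _ _ Hr).
  assert (Hr1 := wt_ren_shift Hr HA0).
  assert (HA1 : isty (ren r A :: D) (wk (ren r A))).
  { replace (wk (ren r A)) with (ren (fun k => S (r k)) A) by tm_eq. auto. }
  assert (Hr2 := wt_ren_shift Hr1 HA1).
  assert (HA2 : isty (wk (ren r A) :: ren r A :: D) (wk (wk (ren r A)))).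
  { replace (wk (wk (ren r A))) with (ren (fun k => S (S (r k))) A) by tm_eq. auto. }
  apply wt_ren_up; [apply wt_ren_up; [now apply wt_ren_up | exact HA1 |] | |].
  - apply ren_wk.
  - exact (isty_ctx_J_head_of_wk (wf_extend HA1) HA2).
  - cbn [ren up_ren]. now rewrite !ren_wk.
Qed.

Create HintDb renaming.
#[local] Hint Resolve isty_El isty_Sig isty_Sum wt_ren_wf wt_ren_up wt_ren_ctx_J
  : renaming.

Ltac ren_premise :=
  rewrite <- ?ren_motive_pair, <- ?ren_motive_inl, <- ?ren_motive_inr,
    <- ?ren_motive_refl, <- ?ren_inst1, <- ?ren_isProp, <- ?ren_arr;
  eauto 9 with renaming.

Lemma judgment_ren :
  (forall G, wf G -> True) /\
  (forall G A, isty G A -> forall D r, wt_ren D r G -> isty D (ren r A)) /\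
  (forall G A B, eqty G A B ->
     forall D r, wt_ren D r G -> eqty D (ren r A) (ren r B)) /\
  (forall G t A, hastm G t A ->
     forall D r, wt_ren D r G -> hastm D (ren r t) (ren r A)) /\
  (forall G t u A, eqtm G t u A ->
     forall D r, wt_ren D r G -> eqtm D (ren r t) (ren r u) (ren r A)).
Proof.
  apply judgment_ind; auto; intros; cbn [ren];
    rewrite ?ren_inst1, ?ren_inst2, ?ren_inst3, ?ren_isProp, ?ren_arr; cbn [ren].
  all: try (econstructor; now eauto with renaming).
  (* The remaining rules have types that the conclusion does not determine, or
     premises in which an instance or a motive has to be commuted with [ren]. *)
  - eauto using wt_ren_var.
  - apply hastm_pair; ren_premise.
  - apply hastm_split with (A := ren r A) (B := ren (up_ren r) B); ren_premise.
  - apply hastm_case with (A := ren r A) (B := ren r B); ren_premise.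
  - apply hastm_J with (A := ren r A); ren_premise.
  - apply hastm_trRec with (A := ren r A); ren_premise.
  - rewrite ren_wk. apply eqtm_eta. ren_premise.
  - apply eqtm_split_pair with (A := ren r A) (B := ren (up_ren r) B); ren_premise.
  - apply eqtm_case_inl with (A := ren r A) (B := ren r B); ren_premise.
  - apply eqtm_case_inr with (A := ren r A) (B := ren r B); ren_premise.
  - apply eqtm_J_refl with (A := ren r A); ren_premise.
  - apply eqtm_trRec_tr with (A := ren r A); ren_premise.
  - apply eqtm_pair; ren_premise.
  - apply eqtm_split with (A := ren r A) (B := ren (up_ren r) B); ren_premise.
  - apply eqtm_case with (A := ren r A) (B := ren r B); ren_premise.
  - apply eqtm_J with (A := ren r A); ren_premise.
  - apply eqtm_trRec with (A := ren r A); ren_premise.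
Qed.

Lemma wt_ren_S {G A} : isty G A -> wt_ren (A :: G) S G.
Proof.
  intros HA. split; [exact (wf_extend HA) |].
  intros n B E. exists B. split; [exact E | tm_eq].
Qed.

Lemma wt_ren_up_S {G A B} :
  isty G A -> isty G B -> wt_ren (wk B :: A :: G) (up_ren S) (B :: G).
Proof.
  intros HA HB. apply wt_ren_up; [now apply wt_ren_S | | reflexivity].
  eapply judgment_ren; eauto using wt_ren_S.
Qed.

Lemma isty_wk {G A B} : isty G A -> isty G B -> isty (A :: G) (wk B).
Proof. intros HA HB. eapply judgment_ren; eauto using wt_ren_S. Qed.

Lemma hastm_wk {G A t B} : isty G A -> hastm G t B -> hastm (A :: G) (wk t) (wk B).
Proof. intros HA Ht. eapply judgment_ren; eauto using wt_ren_S. Qed.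

Lemma isty_wk_up {G A B C} :
  isty G A -> isty G B -> isty (B :: G) C ->
  isty (wk B :: A :: G) (ren (up_ren S) C).
Proof. intros HA HB HC. eapply judgment_ren; eauto using wt_ren_up_S. Qed.

Lemma hastm_varS {G A B n} :
  isty G B -> hastm G (tVar n) A -> hastm (B :: G) (tVar (S n)) (wk A).
Proof. exact hastm_wk. Qed.

Lemma isty_ctx_J_head {G A} :
  isty G A -> isty (wk A :: A :: G) (tId (wk (wk A)) (tVar 1) (tVar 0)).
Proof.
  intros HA. assert (HA1 := isty_wk HA HA).
  apply isty_ctx_J_head_of_wk; auto using wf_extend, isty_wk.
Qed.

Create HintDb typing.
#[local] Hint Resolve isty_El isty_wk hastm_wk hastm_var0 hastm_varS : typing.

Ltac typing := eauto with typing.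

(** * Functions, pairs and paths *)

Lemma isty_arr {G A B} : isty G A -> isty G B -> isty G (tArr A B).
Proof. intros HA HB. apply isty_Pi; typing. Qed.

Lemma hastm_arr_app {G A B f a} :
  hastm G f (tArr A B) -> hastm G a A -> hastm G (tApp f a) B.
Proof.
  intros Hf Ha. eapply hastm_conv_eq; [exact (hastm_app _ _ _ _ _ Hf Ha) | tm_eq].
Qed.

Lemma hastm_isProp_app {G A q a b} :
  hastm G q (tIsProp A) -> hastm G a A -> hastm G b A ->
  hastm G (tApp (tApp q a) b) (tId A a b).
Proof.
  intros Hq Ha Hb. eapply hastm_conv_eq.
  - apply hastm_app with (A := A) (B := tId (wk A) (wk a) (tVar 0)); [| exact Hb].
    eapply hastm_conv_eq; [exact (hastm_app _ _ _ _ _ Hq Ha) | tm_eq].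
  - tm_eq.
Qed.

Lemma hastm_refl_eqtm {G A t u} :
  isty G A -> hastm G t A -> eqtm G t u A -> hastm G (tRefl t) (tId A t u).
Proof.
  intros HA Ht E. eapply hastm_conv; [exact (hastm_refl _ _ _ Ht) |].
  apply eqty_Id; auto using eqty_refl, eqtm_refl.
Qed.

Definition tPr1 (A p : tm) : tm := tSplit (wk A) (tVar 1) p.

Lemma hastm_pr1_branch {G A B} : isty G A -> isty (A :: G) B ->
  hastm (B :: A :: G) (tVar 1) (motive_pair (wk A)).
Proof.
  intros HA HB.
  eapply hastm_conv_eq; [exact (hastm_varS HB (hastm_var0 HA)) | tm_eq].
Qed.

Lemma hastm_pr1 {G A B p} :
  isty G A -> isty (A :: G) B -> hastm G p (tSig A B) -> hastm G (tPr1 A p) A.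
Proof.
  intros HA HB Hp. eapply hastm_conv_eq.
  - apply hastm_split with (A := A) (B := B);
      auto using hastm_pr1_branch, isty_wk, isty_Sig.
  - tm_eq.
Qed.

Lemma eqtm_pr1 {G A B p p'} : isty G A -> isty (A :: G) B ->
  eqtm G p p' (tSig A B) -> eqtm G (tPr1 A p) (tPr1 A p') A.
Proof.
  intros HA HB E. eapply eqtm_conv_eq; [| reflexivity |].
  - apply eqtm_split with (A := A) (B := B);
      eauto using eqtm_refl, eqty_refl, hastm_pr1_branch, isty_wk, isty_Sig.
  - tm_eq.
Qed.

Lemma eqtm_pr1_pair {G A B a b} : isty G A -> isty (A :: G) B ->
  hastm G a A -> hastm G b (inst1 B a) -> eqtm G (tPr1 A (tPair a b)) a A.
Proof.
  intros HA HB Ha Hb. eapply eqtm_conv_eq; [| reflexivity |].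
  - apply eqtm_split_pair with (A := A) (B := B);
      auto using hastm_pr1_branch, isty_wk, isty_Sig.
  - tm_eq.
Qed.

Definition tSigInd (A B C d : tm) : tm :=
  tLam (tSig A B)
    (tSplit (ren (up_ren S) C) (ren (up_ren (up_ren S)) d) (tVar 0)).

Lemma hastm_sig_ind {G A B C d} : isty G A -> isty (A :: G) B ->
  isty (tSig A B :: G) C -> hastm (B :: A :: G) d (motive_pair C) ->
  hastm G (tSigInd A B C d) (tPi (tSig A B) C).
Proof.
  intros HA HB HC Hd. assert (HS := isty_Sig _ _ _ HA HB).
  apply hastm_lam; [exact HS |]. eapply hastm_conv_eq.
  - apply hastm_split with (A := wk A) (B := ren (up_ren S) B).
    + exact (isty_wk HS HA).
    + exact (isty_wk_up HS HA HB).
    + exact (isty_wk_up HS HS HC).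
    + rewrite <- ren_motive_pair. eapply judgment_ren; [exact Hd |].
      apply wt_ren_up; auto using wt_ren_up_S, isty_wk_up.
    + exact (hastm_var0 HS).
  - tm_eq.
Qed.

Lemma subst_sig_ind s A B C d :
  subst s (tSigInd A B C d) =
  tSigInd (subst s A) (subst (up s) B) (subst (up s) C) (subst (up (up s)) d).
Proof. unfold tSigInd. tm_eq. Qed.

Definition tTransport (P a b p : tm) : tm :=
  tJ (tArr (wk (wk P)) (wk (ren (up_ren S) P))) (tLam P (tVar 0)) a b p.

Lemma hastm_transport {G A P a b p} : isty G A -> isty (A :: G) P ->
  hastm G a A -> hastm G b A -> hastm G p (tId A a b) ->
  hastm G (tTransport P a b p) (tArr (inst1 P a) (inst1 P b)).
Proof.
  intros HA HP Ha Hb Hp. assert (HA1 := isty_wk HA HA).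
  eapply hastm_conv_eq.
  - apply hastm_J with (A := A); auto.
    + apply isty_arr; (apply isty_wk; [now apply isty_ctx_J_head |]).
      * now apply isty_wk.
      * now apply isty_wk_up.
    + eapply hastm_conv_eq; [exact (hastm_lam _ _ _ _ HP (hastm_var0 HP)) | tm_eq].
  - tm_eq.
Qed.

Lemma subst_transport s P a b p :
  subst s (tTransport P a b p) =
  tTransport (subst (up s) P) (subst s a) (subst s b) (subst s p).
Proof. unfold tTransport. tm_eq. Qed.

Definition tConcatAp (Y c g a b p q : tm) : tm :=
  tApp (tTransport (tId (wk Y) (wk c) (tApp (wk g) (tVar 0))) a b p) q.

Lemma hastm_concat_ap {G A Y c g a b p q} : isty G A -> isty G Y ->
  hastm G c Y -> hastm G g (tArr A Y) -> hastm G a A -> hastm G b A ->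
  hastm G p (tId A a b) -> hastm G q (tId Y c (tApp g a)) ->
  hastm G (tConcatAp Y c g a b p q) (tId Y c (tApp g b)).
Proof.
  intros HA HY Hc Hg Ha Hb Hp Hq.
  assert (HP : isty (A :: G) (tId (wk Y) (wk c) (tApp (wk g) (tVar 0)))).
  { apply isty_Id; typing. eapply hastm_arr_app; [| exact (hastm_var0 HA)].
    eapply hastm_conv_eq; [exact (hastm_wk HA Hg) | tm_eq]. }
  eapply hastm_arr_app; [| exact Hq].
  eapply hastm_conv_eq; [exact (hastm_transport HA HP Ha Hb Hp) | tm_eq].
Qed.

Lemma subst_concat_ap s Y c g a b p q :
  subst s (tConcatAp Y c g a b p q) =
  tConcatAp (subst s Y) (subst s c) (subst s g) (subst s a) (subst s b)
    (subst s p) (subst s q).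
Proof. unfold tConcatAp. cbn [subst]. rewrite subst_transport. tm_eq. Qed.

Definition tPathsTo (A b : tm) : tm := tId (wk A) (tVar 0) (wk b).

Lemma isty_paths_to {G A b} :
  isty G A -> hastm G b A -> isty (A :: G) (tPathsTo A b).
Proof. intros HA Hb. apply isty_Id; typing. Qed.

Definition tInvConcat (A c a b p q : tm) : tm :=
  tApp (tTransport (tPathsTo A b) c a p) q.

#[local] Hint Unfold tPathsTo : terms.

Lemma hastm_inv_concat {G A c a b p q} : isty G A ->
  hastm G c A -> hastm G a A -> hastm G b A ->
  hastm G p (tId A c a) -> hastm G q (tId A c b) ->
  hastm G (tInvConcat A c a b p q) (tId A a b).
Proof.
  intros HA Hc Ha Hb Hp Hq. eapply hastm_arr_app; [| exact Hq].
  eapply hastm_conv_eq;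
    [exact (hastm_transport HA (isty_paths_to HA Hb) Hc Ha Hp) | tm_eq].
Qed.

(** * Contractibility of singletons *)

Definition tIsCenter (A c : tm) : tm := tPi A (tId (wk A) (wk c) (tVar 0)).

Lemma wk_isCenter A c : wk (tIsCenter A c) = tIsCenter (wk A) (wk c).
Proof. unfold tIsCenter. tm_eq. Qed.

Lemma hastm_isCenter_app {G A c k a} :
  hastm G k (tIsCenter A c) -> hastm G a A -> hastm G (tApp k a) (tId A c a).
Proof.
  intros Hk Ha. eapply hastm_conv_eq; [exact (hastm_app _ _ _ _ _ Hk Ha) | tm_eq].
Qed.

Definition tContrIsProp (A c k : tm) : tm :=
  tLam A (tLam (wk A)
    (tInvConcat (wk (wk A)) (wk (wk c)) (tVar 1) (tVar 0)
       (tApp (wk (wk k)) (tVar 1)) (tApp (wk (wk k)) (tVar 0)))).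

Lemma hastm_contr_isProp {G A c k} : isty G A -> hastm G c A ->
  hastm G k (tIsCenter A c) -> hastm G (tContrIsProp A c k) (tIsProp A).
Proof.
  intros HA Hc Hk. assert (HA1 := isty_wk HA HA).
  assert (Hk2 := hastm_wk HA1 (hastm_wk HA Hk)). rewrite !wk_isCenter in Hk2.
  apply hastm_lam; [exact HA |]. apply hastm_lam; [exact HA1 |].
  apply hastm_inv_concat; eauto using hastm_isCenter_app with typing.
Qed.

Lemma subst_contr_isProp s A c k :
  subst s (tContrIsProp A c k) =
  tContrIsProp (subst s A) (subst s c) (subst s k).
Proof. unfold tContrIsProp, tInvConcat, tTransport. tm_eq. Qed.

Definition tSing (Y c : tm) : tm := tSig Y (tPathsTo Y c).

#[local] Hint Unfold tIsCenter tSing : terms.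

Lemma subst_sing s Y c : subst s (tSing Y c) = tSing (subst s Y) (subst s c).
Proof. tm_eq. Qed.

Lemma isty_sing {G Y c} : isty G Y -> hastm G c Y -> isty G (tSing Y c).
Proof. intros HY Hc. apply isty_Sig; auto using isty_paths_to. Qed.

Lemma hastm_sing_U {G Y c} :
  hastm G Y tU -> hastm G c Y -> hastm G (tSing Y c) tU.
Proof.
  intros HY Hc. assert (HY' := isty_El _ _ HY).
  apply hastm_Sig; [exact HY |]. apply hastm_Id; typing.
  exact (hastm_wk HY' HY).
Qed.

Lemma hastm_sing_pair {G Y c y p} : isty G Y -> hastm G c Y ->
  hastm G y Y -> hastm G p (tId Y y c) -> hastm G (tPair y p) (tSing Y c).
Proof.
  intros HY Hc Hy Hp. apply hastm_pair; auto using isty_paths_to.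
  eapply hastm_conv_eq; [exact Hp | tm_eq].
Qed.

Definition tSingCenter (c : tm) : tm := tPair c (tRefl c).

Lemma hastm_sing_center {G Y c} :
  isty G Y -> hastm G c Y -> hastm G (tSingCenter c) (tSing Y c).
Proof. intros HY Hc. apply hastm_sing_pair; auto using hastm_refl. Qed.

Definition tSingPath (Y c y p : tm) : tm :=
  tJ (tId (tSing (wk (wk (wk Y))) (tVar 1)) (tSingCenter (tVar 1))
        (tPair (tVar 2) (tVar 0)))
     (tRefl (tSingCenter (tVar 0))) y c p.

#[local] Hint Unfold tSingCenter tSingPath : terms.

Lemma hastm_sing_path {G Y c y p} : isty G Y -> hastm G c Y ->
  hastm G y Y -> hastm G p (tId Y y c) ->
  hastm G (tSingPath Y c y p) (tId (tSing Y c) (tSingCenter c) (tPair y p)).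
Proof.
  intros HY Hc Hy Hp.
  assert (HY1 := isty_wk HY HY). assert (HJ := isty_ctx_J_head HY).
  assert (HY3 : isty (ctx_J G Y) (wk (wk (wk Y)))).
  { exact (isty_wk HJ (isty_wk HY1 HY1)). }
  assert (Hend : hastm (ctx_J G Y) (tVar 1) (wk (wk (wk Y)))).
  { exact (hastm_varS HJ (hastm_var0 HY1)). }
  eapply hastm_conv_eq.
  - apply hastm_J with (A := Y); auto.
    + apply isty_Id; auto using isty_sing, hastm_sing_center.
      apply hastm_sing_pair; auto.
      * exact (hastm_varS HJ (hastm_varS HY1 (hastm_var0 HY))).
      * exact (hastm_var0 HJ).
    + eapply hastm_conv_eq.
      * apply hastm_refl. exact (hastm_sing_center HY1 (hastm_var0 HY)).
      * tm_eq.
  - tm_eq.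
Qed.

Definition tSingContr (Y c : tm) : tm :=
  tSigInd Y (tPathsTo Y c)
    (tId (wk (tSing Y c)) (wk (tSingCenter c)) (tVar 0))
    (tSingPath (wk (wk Y)) (wk (wk c)) (tVar 1) (tVar 0)).

Lemma hastm_sing_contr {G Y c} : isty G Y -> hastm G c Y ->
  hastm G (tSingContr Y c) (tIsCenter (tSing Y c) (tSingCenter c)).
Proof.
  intros HY Hc.
  assert (HF := isty_paths_to HY Hc). assert (HS := isty_sing HY Hc).
  apply hastm_sig_ind; auto.
  - apply isty_Id; auto using isty_wk, hastm_wk, hastm_sing_center, hastm_var0.
  - eapply hastm_conv_eq.
    + apply (hastm_sing_path (Y := wk (wk Y))); typing.
    + tm_eq.
Qed.

Definition tSingIsProp (Y c : tm) : tm :=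
  tContrIsProp (tSing Y c) (tSingCenter c) (tSingContr Y c).

Lemma hastm_sing_isProp {G Y c} : isty G Y -> hastm G c Y ->
  hastm G (tSingIsProp Y c) (tIsProp (tSing Y c)).
Proof.
  intros HY Hc.
  apply hastm_contr_isProp;
    auto using isty_sing, hastm_sing_center, hastm_sing_contr.
Qed.

Lemma subst_sing_isProp s Y c :
  subst s (tSingIsProp Y c) = tSingIsProp (subst s Y) (subst s c).
Proof.
  unfold tSingIsProp, tSingContr.
  rewrite subst_contr_isProp, subst_sig_ind. f_equal; tm_eq.
Qed.

(** * Factorization through the truncation *)

Definition tHomotopy (X Y f fbar : tm) : tm :=
  tPi X (tId (wk Y) (tApp (wk f) (tVar 0)) (tApp (wk fbar) (tTr (tVar 0)))).

Record factors_upto_homotopy (G : ctx) (X Y f fbar h : tm) : Prop := {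
  factors_dom : hastm G X tU;
  factors_cod : hastm G Y tU;
  factors_map : hastm G f (tArr X Y);
  factors_ext : hastm G fbar (tArr (tTrunc X) Y);
  factors_htpy : hastm G h (tHomotopy X Y f fbar) }.

Arguments factors_dom {G X Y f fbar h}.

Lemma factors_upto_homotopy_wk {G A X Y f fbar h} : isty G A ->
  factors_upto_homotopy G X Y f fbar h ->
  factors_upto_homotopy (A :: G) (wk X) (wk Y) (wk f) (wk fbar) (wk h).
Proof.
  intros HA [HX HY Hf Hfbar Hh].
  split; [exact (hastm_wk HA HX) | exact (hastm_wk HA HY) | | |];
    (eapply hastm_conv_eq;
      [eapply (hastm_wk HA); eassumption | unfold tHomotopy; tm_eq]).
Qed.

Definition tLiftPath (X Y f fbar h z x : tm) : tm :=
  tConcatAp Y (tApp f x) fbar (tTr x) z (tApp (tApp (tTrProp X) (tTr x)) z)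
    (tApp h x).

Lemma hastm_lift_path {G X Y f fbar h z x} :
  factors_upto_homotopy G X Y f fbar h ->
  hastm G z (tTrunc X) -> hastm G x X ->
  hastm G (tLiftPath X Y f fbar h z x) (tId Y (tApp f x) (tApp fbar z)).
Proof.
  intros [HX HY Hf Hfbar Hh] Hz Hx. assert (Htr := hastm_tr _ _ _ HX Hx).
  apply (hastm_concat_ap (A := tTrunc X));
    eauto using isty_El, hastm_Trunc, hastm_arr_app.
  - exact (hastm_isProp_app (hastm_trProp _ _ HX) Htr Hz).
  - eapply hastm_conv_eq; [exact (hastm_app _ _ _ _ _ Hh Hx) | tm_eq].
Qed.

Definition tLiftPair (X Y f fbar h z x : tm) : tm :=
  tPair (tApp f x) (tLiftPath X Y f fbar h z x).

Lemma hastm_lift_pair {G X Y f fbar h z x} :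
  factors_upto_homotopy G X Y f fbar h ->
  hastm G z (tTrunc X) -> hastm G x X ->
  hastm G (tLiftPair X Y f fbar h z x) (tSing Y (tApp fbar z)).
Proof.
  intros F Hz Hx. assert (Hp := hastm_lift_path F Hz Hx).
  destruct F as [HX HY Hf Hfbar Hh].
  apply hastm_sing_pair; eauto using isty_El, hastm_arr_app.
Qed.

Lemma subst_lift_pair s X Y f fbar h z x :
  subst s (tLiftPair X Y f fbar h z x) =
  tLiftPair (subst s X) (subst s Y) (subst s f) (subst s fbar) (subst s h)
    (subst s z) (subst s x).
Proof.
  unfold tLiftPair, tLiftPath. cbn [subst]. now rewrite subst_concat_ap.
Qed.

Definition tLiftSing (X Y f fbar h z : tm) : tm :=
  tLam X (tLiftPair (wk X) (wk Y) (wk f) (wk fbar) (wk h) (wk z) (tVar 0)).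

Lemma hastm_lift_body {G X Y f fbar h z} :
  factors_upto_homotopy G X Y f fbar h -> hastm G z (tTrunc X) ->
  hastm (X :: G)
    (tLiftPair (wk X) (wk Y) (wk f) (wk fbar) (wk h) (wk z) (tVar 0))
    (wk (tSing Y (tApp fbar z))).
Proof.
  intros F Hz. assert (HX := isty_El _ _ (factors_dom F)). eapply hastm_conv_eq.
  - exact (hastm_lift_pair (factors_upto_homotopy_wk HX F) (hastm_wk HX Hz)
             (hastm_var0 HX)).
  - tm_eq.
Qed.

Lemma hastm_lift_sing {G X Y f fbar h z} :
  factors_upto_homotopy G X Y f fbar h -> hastm G z (tTrunc X) ->
  hastm G (tLiftSing X Y f fbar h z) (tArr X (tSing Y (tApp fbar z))).
Proof.
  intros F Hz. apply hastm_lam; [| now apply hastm_lift_body].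
  exact (isty_El _ _ (factors_dom F)).
Qed.

Lemma eqtm_lift_sing_app {G X Y f fbar h z x} :
  factors_upto_homotopy G X Y f fbar h ->
  hastm G z (tTrunc X) -> hastm G x X ->
  eqtm G (tApp (tLiftSing X Y f fbar h z) x) (tLiftPair X Y f fbar h z x)
    (tSing Y (tApp fbar z)).
Proof.
  intros F Hz Hx. eapply eqtm_conv_eq.
  - apply eqtm_beta; [| now apply hastm_lift_body | exact Hx].
    exact (isty_El _ _ (factors_dom F)).
  - unfold inst1. rewrite subst_lift_pair. f_equal; tm_eq.
  - tm_eq.
Qed.

Definition tFactorSing (X Y f fbar h z : tm) : tm :=
  tTrRec (tSing Y (tApp fbar z)) (tSingIsProp Y (tApp fbar z))
    (tLiftSing X Y f fbar h z) z.

Lemma hastm_factor_sing {G X Y f fbar h z} :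
  factors_upto_homotopy G X Y f fbar h -> hastm G z (tTrunc X) ->
  hastm G (tFactorSing X Y f fbar h z) (tSing Y (tApp fbar z)).
Proof.
  intros F Hz. assert (HL := hastm_lift_sing F Hz).
  destruct F as [HX HY Hf Hfbar Hh]. assert (Hc := hastm_arr_app Hfbar Hz).
  apply hastm_trRec with (A := X);
    auto using isty_El, hastm_sing_U, hastm_sing_isProp.
Qed.

Lemma eqtm_factor_sing_tr {G X Y f fbar h x} :
  factors_upto_homotopy G X Y f fbar h -> hastm G x X ->
  eqtm G (tFactorSing X Y f fbar h (tTr x))
    (tLiftPair X Y f fbar h (tTr x) x) (tSing Y (tApp fbar (tTr x))).
Proof.
  intros F Hx. assert (Hz := hastm_tr _ _ _ (factors_dom F) Hx).
  eapply eqtm_trans; [| exact (eqtm_lift_sing_app F Hz Hx)].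
  assert (HL := hastm_lift_sing F Hz). destruct F as [HX HY Hf Hfbar Hh].
  assert (Hc := hastm_arr_app Hfbar Hz).
  apply eqtm_trRec_tr with (A := X);
    auto using isty_El, hastm_sing_U, hastm_sing_isProp.
Qed.

Definition tFactorAt (X Y f fbar h z : tm) : tm :=
  tPr1 Y (tFactorSing X Y f fbar h z).

Lemma hastm_factor_at {G X Y f fbar h z} :
  factors_upto_homotopy G X Y f fbar h -> hastm G z (tTrunc X) ->
  hastm G (tFactorAt X Y f fbar h z) Y.
Proof.
  intros F Hz. assert (HS := hastm_factor_sing F Hz).
  destruct F as [HX HY Hf Hfbar Hh]. assert (HY' := isty_El _ _ HY).
  exact (hastm_pr1 HY' (isty_paths_to HY' (hastm_arr_app Hfbar Hz)) HS).
Qed.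

Lemma eqtm_factor_at_tr {G X Y f fbar h x} :
  factors_upto_homotopy G X Y f fbar h -> hastm G x X ->
  eqtm G (tFactorAt X Y f fbar h (tTr x)) (tApp f x) Y.
Proof.
  intros F Hx. assert (Hz := hastm_tr _ _ _ (factors_dom F) Hx).
  assert (HE := eqtm_factor_sing_tr F Hx). assert (Hp := hastm_lift_path F Hz Hx).
  destruct F as [HX HY Hf Hfbar Hh]. assert (HY' := isty_El _ _ HY).
  assert (HF := isty_paths_to HY' (hastm_arr_app Hfbar Hz)).
  eapply eqtm_trans; [exact (eqtm_pr1 HY' HF HE) |].
  apply (eqtm_pr1_pair HY' HF (hastm_arr_app Hf Hx)).
  eapply hastm_conv_eq; [exact Hp | tm_eq].
Qed.

Lemma subst_factor_at s X Y f fbar h z :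
  subst s (tFactorAt X Y f fbar h z) =
  tFactorAt (subst s X) (subst s Y) (subst s f) (subst s fbar) (subst s h)
    (subst s z).
Proof.
  unfold tFactorAt, tPr1, tFactorSing, tLiftSing. cbn [subst].
  rewrite subst_sing, subst_sing_isProp, subst_lift_pair. tm_eq.
Qed.

Definition tFactor (X Y f fbar h : tm) : tm :=
  tLam (tTrunc X)
    (tFactorAt (wk X) (wk Y) (wk f) (wk fbar) (wk h) (tVar 0)).

Lemma wk_factor X Y f fbar h :
  wk (tFactor X Y f fbar h) =
  tFactor (wk X) (wk Y) (wk f) (wk fbar) (wk h).
Proof.
  unfold tFactor, wk at 1. cbn [ren].
  rewrite !(ren_as_subst (up_ren S)), subst_factor_at. f_equal. f_equal; tm_eq.
Qed.

Lemma hastm_factor_body {G X Y f fbar h} :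
  factors_upto_homotopy G X Y f fbar h ->
  hastm (tTrunc X :: G)
    (tFactorAt (wk X) (wk Y) (wk f) (wk fbar) (wk h) (tVar 0)) (wk Y).
Proof.
  intros F.
  assert (HT := isty_El _ _ (hastm_Trunc _ _ (factors_dom F))).
  exact (hastm_factor_at (factors_upto_homotopy_wk HT F) (hastm_var0 HT)).
Qed.

Lemma hastm_factor {G X Y f fbar h} :
  factors_upto_homotopy G X Y f fbar h ->
  hastm G (tFactor X Y f fbar h) (tArr (tTrunc X) Y).
Proof.
  intros F. apply hastm_lam; [| now apply hastm_factor_body].
  exact (isty_El _ _ (hastm_Trunc _ _ (factors_dom F))).
Qed.

Lemma eqtm_factor_tr {G X Y f fbar h x} :
  factors_upto_homotopy G X Y f fbar h -> hastm G x X ->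
  eqtm G (tApp f x) (tApp (tFactor X Y f fbar h) (tTr x)) Y.
Proof.
  intros F Hx. apply eqtm_sym.
  eapply eqtm_trans; [| exact (eqtm_factor_at_tr F Hx)].
  assert (HX := factors_dom F). eapply eqtm_conv_eq.
  - apply eqtm_beta;
      [exact (isty_El _ _ (hastm_Trunc _ _ HX)) | now apply hastm_factor_body |].
    exact (hastm_tr _ _ _ HX Hx).
  - unfold inst1. rewrite subst_factor_at. f_equal; tm_eq.
  - tm_eq.
Qed.

Theorem theorem8p4 (G : ctx) (X Y f fbar h : tm)
  (HG : wf G)
  (HX : hastm G X tU)
  (HY : hastm G Y tU)
  (Hf : hastm G f (tArr X Y))
  (Hfbar : hastm G fbar (tArr (tTrunc X) Y))
  (Hh : hastm G h
          (tPi X (tId (wk Y) (tApp (wk f) (tVar 0))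
                             (tApp (wk fbar) (tTr (tVar 0)))))) :
  exists f' : tm,
    hastm G f' (tArr (tTrunc X) Y) /\
    eqtm (X :: G) (tApp (wk f) (tVar 0)) (tApp (wk f') (tTr (tVar 0))) (wk Y) /\
    hastm G (tLam X (tRefl (tApp (wk f) (tVar 0))))
      (tPi X (tId (wk Y) (tApp (wk f) (tVar 0))
                         (tApp (wk f') (tTr (tVar 0))))).
Proof.
  assert (F : factors_upto_homotopy G X Y f fbar h) by now constructor.
  assert (HX' := isty_El _ _ HX). assert (F1 := factors_upto_homotopy_wk HX' F).
  assert (E := eqtm_factor_tr F1 (hastm_var0 HX')). rewrite <- wk_factor in E.
  exists (tFactor X Y f fbar h).
  split; [exact (hastm_factor F) | split; [exact E |]].
  apply hastm_lam; [exact HX' |].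
  destruct F1 as [_ HY1 Hf1 _ _].
  exact (hastm_refl_eqtm (isty_El _ _ HY1) (hastm_arr_app Hf1 (hastm_var0 HX')) E).
Qed.
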